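(* Let $A$ be a commutative ring, $k\ge1$, $\vec s=(n_1,\dots,n_k)$ a tuple of positive integers, and $X_\bullet=X_\bullet(\vec s;A)$ the diagonal simplicial tensor module with its boundary $\partial$, shift-and-truncate homotopy $H$ and shifted depth filtration $\mathcal F^\bullet$. The differential $\partial$ and the homotopy $H$ preserve the shifted depth filtration (filtration degree $0$). For all $t\in\mathbb Z$: 1. for all $p\ge1$ and all $i\in\{0,\dots,p\}$, $d_i^p(\mathcal F^tX_p)\subseteq\mathcal F^tX_{p-1}$; 2. for all $p\ge0$, $H_p(\mathcal F^tX_p)\subseteq\mathcal F^tX_{p+1}$.
   Context: Notation: $[p]=\{0,\dots,p\}$. For a shape $\vec s=(n_1,\dots,n_k)$ put $n=\min(n_1,\dots,n_k)-1$, $M_a(p)=n_a-1-n+p$ (so $M_a(p)\ge p$) and $I_p=\prod_{a=1}^k[M_a(p)]$ for $p\ge 0$. Let $\delta_i^q:[q-1]\to[q]$ be the increasing injection missing $i$, and $\Delta_i^p=\prod_{a=1}^k\delta_i^{M_a(p)}:I_{p-1}\to I_p$ ($p\ge1$, $0\le i\le p$). The diagonal simplicial tensor module has $X_p=A^{I_p}$ (all functions $T:I_p\to A$) and faces $d_i^p(T)=T\circ\Delta_i^p$; the boundary is $\partial_p=\sum_{i=0}^p(-1)^id_i^p$ for $p\ge1$, with $\partial_0=0$ and $X_p=0$ for $p<0$. The shift-and-truncate homotopy $H_p:X_p\to X_{p+1}$ ($p\ge0$) is: $H_p(T)(m)=0$ if some $m_a=0$, and $H_p(T)(m)=T(m-\vec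 1)$ if all $m_a>0$, for $m\in I_{p+1}$, $\vec1=(1,\dots,1)$; $H_{-1}=0$. The shifted depth filtration is, for $p\ge0$ and $t\in\mathbb Z$, $\mathcal F^tX_p=\{T\in X_p: T(m)=0\text{ unless }\min_a m_a\ge t+p\}$. *)

(* Defs.v *)
From mathcomp Require Import all_boot all_order all_algebra.
Set Implicit Arguments.
Unset Strict Implicit.
Unset Printing Implicit Defensive.
Import GRing.Theory Num.Theory.
Local Open Scope ring_scope.

(* Shapes with k >= 1 entries are tuples of length k.+1, so that the minimum  *)
(* over the indices can be based at ord0; positivity of the entries is left   *)
(* as a hypothesis.                                                           *)
Definition min_ord k (m : 'I_k.+1 -> nat) : nat :=
  \big[minn/m ord0]_(a < k.+1) m a.

Definition shape_dim k (s : k.+1.-tuple nat) : nat := (min_ord (tnth s)).-1.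

(* n_a - 1 - n; the truncated subtractions are exact for positive shapes.     *)
Definition shape_excess k (s : k.+1.-tuple nat) (a : 'I_k.+1) : nat :=
  ((tnth s a).-1 - shape_dim s)%N.

(* Adding p on the left makes shape_max s p.+1 a convertible to               *)
(* (shape_max s p a).+1, so no cast is needed in the maps below.              *)
Definition shape_max k (s : k.+1.-tuple nat) (p : nat) (a : 'I_k.+1) : nat :=
  (p + shape_excess s a)%N.

Definition multi_index k (s : k.+1.-tuple nat) (p : nat) :=
  {dffun forall a : 'I_k.+1, 'I_(shape_max s p a).+1}.

Definition tensor_module k (s : k.+1.-tuple nat) (A : comPzRingType)
    (p : nat) := {ffun multi_index s p -> A^o}.

(* Faces and boundaries with source degree q >= 1 are indexed by p = q - 1.   *)

(* i <= p.+1 <= shape_max s p.+1 a, and lshift is the resulting inclusion;    *)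
(* lift h is the increasing injection that misses h.                          *)
Definition coface k (s : k.+1.-tuple nat) (p : nat) (i : 'I_p.+2)
    (m : multi_index s p) : multi_index s p.+1 :=
  finfun (fun a => lift (lshift (shape_excess s a) i) (m a)
                   : 'I_(shape_max s p.+1 a).+1).

Definition face k (s : k.+1.-tuple nat) (A : comPzRingType) (p : nat)
    (i : 'I_p.+2) (T : tensor_module s A p.+1) : tensor_module s A p :=
  [ffun m => T (coface i m)].

Definition boundary k (s : k.+1.-tuple nat) (A : comPzRingType) (p : nat)
    (T : tensor_module s A p.+1) : tensor_module s A p :=
  \sum_(i < p.+2) (-1) ^+ i *: face i T.

(* m - (1, ..., 1); only used when all the entries of m are positive.         *)
Definition multi_pred k (s : k.+1.-tuple nat) (p : nat)
    (m : multi_index s p.+1) : multi_index s p :=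
  finfun (fun a => inord (m a).-1 : 'I_(shape_max s p a).+1).

Definition shift_homotopy k (s : k.+1.-tuple nat) (A : comPzRingType)
    (p : nat) (T : tensor_module s A p) : tensor_module s A p.+1 :=
  [ffun m : multi_index s p.+1 =>
    if [exists a, m a == 0 :> nat] then 0 else T (multi_pred m)].

Definition depth_filtration k (s : k.+1.-tuple nat) (A : comPzRingType)
    (p : nat) (t : int) : {pred tensor_module s A p} :=
  [pred T : tensor_module s A p | [forall m : multi_index s p,
    ~~ (t + p%:Z <= (min_ord (fun a => m a))%:Z) ==> (T m == 0)]].
Arguments depth_filtration {k} s A p t.

(* Main.v *)
Require Import Defs.
From mathcomp Require Import all_boot all_order all_algebra zify.
Local Open Scope ring_scope.

(** By [depth_filtrationP], a tensor of degree [p] lies in level [t] exactly when it vanishes at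
    every index having some coordinate below [t + p]. This threshold grows by one with the degree. A
    coface raises each coordinate by at most one ([coface_le]), so a coordinate below the threshold
    stays below the next one; hence faces, and their signed sums, preserve the level. The homotopy
    either gives zero or lowers every coordinate by exactly one ([multi_predE]), matching the drop
    of the threshold. *)

Lemma min_ord_leq k (m : 'I_k.+1 -> nat) a : (min_ord m <= m a)%N.
Proof. by rewrite /min_ord -minEnat -leEnat Order.TotalTheory.bigmin_le. Qed.

Lemma min_ord_attained k (m : 'I_k.+1 -> nat) : exists a, min_ord m = m a.
Proof.
rewrite /min_ord; apply: (big_ind (fun x => exists a, x = m a)).
- by exists ord0.
- by move=> _ _ [a ->] [b ->]; case: leqP => _; [exists a | exists b].
- by move=> a _; exists a.
Qed.

(** Since the minimum is attained, it is below the threshold iff some coordinate is; later arguments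
    can thus follow one fixed coordinate. *)
Lemma depth_filtrationP k (s : k.+1.-tuple nat) (A : comPzRingType) p t
    (T : tensor_module s A p) :
  reflect (forall (m : multi_index s p) a, (m a)%:Z < t + p%:Z -> T m = 0)
          (T \in depth_filtration s A p t).
Proof.
apply: (iffP forallP) => [T_F m a lt_ma | T_0 m].
- apply/eqP/(implyP (T_F m)).
  by have := @min_ord_leq k (fun a => m a) a; lia.
- apply/implyP; have [a ->] := @min_ord_attained k (fun a => m a).
  by rewrite -Order.TotalTheory.ltNge => lt_ma; apply/eqP/(T_0 m a lt_ma).
Qed.

Lemma coface_le k (s : k.+1.-tuple nat) p (i : 'I_p.+2) (m : multi_index s p) a :
  (coface i m a <= (m a).+1)%N.
(* The value of [lift] is [bump], a boolean added to [m a]. *)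
Proof. by rewrite ffunE -[leqRHS]add1n leq_add2r leq_b1. Qed.

Lemma multi_predE k (s : k.+1.-tuple nat) p (m : multi_index s p.+1) a :
  multi_pred m a = (m a).-1 :> nat.
Proof.
(* [inord] does not fall back to its default: the predecessor of a coordinate bounded in degree
   [p.+1] fits the bound in degree [p], and a zero coordinate stays zero. *)
rewrite ffunE inordK //; have := ltn_ord (m a).
by rewrite /shape_max; lia.
Qed.

Lemma face_depth_filtration k (s : k.+1.-tuple nat) (A : comPzRingType) t p
    (i : 'I_p.+2) (T : tensor_module s A p.+1) :
  T \in depth_filtration s A p.+1 t -> face i T \in depth_filtration s A p t.
Proof.
move=> /depth_filtrationP T_0; apply/depth_filtrationP => m a lt_ma.
rewrite ffunE; apply: (T_0 _ a).
by have := @coface_le k s p i m a; lia.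
Qed.

Lemma boundary_depth_filtration k (s : k.+1.-tuple nat) (A : comPzRingType) t p
    (T : tensor_module s A p.+1) :
  T \in depth_filtration s A p.+1 t -> boundary T \in depth_filtration s A p t.
Proof.
move=> T_F; apply/depth_filtrationP => m a lt_ma.
rewrite /boundary sum_ffunE big1 // => i _.
have /depth_filtrationP face_0 := @face_depth_filtration k s A t p i T T_F.
by rewrite ffunE (face_0 m a lt_ma) GRing.scaler0.
Qed.

Lemma shift_homotopy_depth_filtration k (s : k.+1.-tuple nat)
    (A : comPzRingType) t p (T : tensor_module s A p) :
  T \in depth_filtration s A p t ->
  shift_homotopy T \in depth_filtration s A p.+1 t.
Proof.
move=> /depth_filtrationP T_0; apply/depth_filtrationP => m a lt_ma.
(* Truncation is what saves the case [m a = 0]: there the predecessor does not drop, and the strict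
   bound would fail when [t + p = 0]. *)
rewrite ffunE; case: ifPn => // /existsPn /(_ a) ma_neq0.
by apply: (T_0 _ a); rewrite multi_predE; lia.
Qed.

Theorem mainTheorem7 (A : comPzRingType) (k : nat) (s : k.+1.-tuple nat)
    (hs : forall a : 'I_k.+1, (0 < tnth s a)%N) (t : int) :
  [/\ (forall (p : nat) (T : tensor_module s A p.+1),
        T \in depth_filtration s A p.+1 t ->
        boundary T \in depth_filtration s A p t),
      (forall (p : nat) (i : 'I_p.+2) (T : tensor_module s A p.+1),
        T \in depth_filtration s A p.+1 t ->
        face i T \in depth_filtration s A p t)
    & (forall (p : nat) (T : tensor_module s A p),
        T \in depth_filtration s A p t ->
        shift_homotopy T \in depth_filtration s A p.+1 t)].
Proof.
split=> p.
- exact: boundary_depth_filtration.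
- exact: face_depth_filtration.
- exact: shift_homotopy_depth_filtration.
Qed.
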